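(* Let $F$ be a free filter on $\omega$. The following are equivalent: (1) $F$ does not have the Nikodym property; (2) there is a density submeasure $\varphi$ on $\omega$ with $\varphi(\omega)=\infty$ and $F\le_K\mathrm{Exh}(\varphi)^*$; (3) there is a non-pathological lower semicontinuous submeasure $\varphi$ on $\omega$ with $\varphi(\omega)=\infty$ and $F\le_K\mathrm{Exh}(\varphi)^*$.
   Context: For a free filter $F$, $N_F=\omega\cup\{p_F\}$ has points of $\omega$ isolated and neighbourhoods $A\cup\{p_F\}$, $A\in F$, of $p_F$; $F$ has the Nikodym property if there is no sequence of finitely supported measures $\mu_n=\sum_i\alpha_i\delta_{x_i}$ on $N_F$ with $\sum|\alpha_i|\to\infty$ and $\mu_n(A)\to0$ for every clopen $A$. A submeasure $\varphi\colon\mathcal P(\omega)\to[0,\infty]$ has $\varphi(\emptyset)=0$, finite values on singletons, is monotone and subadditive; it is lsc if $\varphi(A)=\lim_n\varphi(A\cap[0,n])$; non-pathological if $\varphi(A)=\sup\{\mu(A):\mu$ non-negative measure on $\omega$, $\mu\le\varphi\}$; a density submeasure if $\varphi=\sup_n\mu_n$ for finitely supported non-negative measures $\mu_n$ on $\omega$ with pairwise disjoint supports. $\mathrm{Exh}(\varphi)=\{A:\lim_n\varphi(A\setminus[0,n])=0\}$; $S^*=\{\omega\setminus X:X\in S\}$. For filters $F\le_K G$ means there is $f\colon\omega\to\omega$ with $f^{-1}[A]\in G$ for all $A\in F$. *)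

(* Defs.v *)
From HB Require Import structures.
From mathcomp Require Import all_boot all_order all_algebra finmap.
From mathcomp Require Import all_classical all_reals all_analysis.
Import Order.TTheory GRing.Theory Num.Theory.
Import numFieldNormedType.Exports.

Set Implicit Arguments.
Unset Strict Implicit.
Unset Printing Implicit Defensive.

Local Open Scope classical_set_scope.
Local Open Scope ring_scope.
Local Open Scope ereal_scope.

Definition free_filter (F : pfilter_on nat) : Prop :=
  \bigcap_(A in (F : set_system nat)) A = set0.

(* The space omega + {p_F}: [Some n] is the point n, [None] is p_F. *)
Definition NF (F : pfilter_on nat) : Type := option nat.

Section NF_topology.
Variable F : pfilter_on nat.

HB.instance Definition _ := Choice.copy (NF F) (option nat).

Definition NF_nbhs (x : NF F) : set_system (NF F) :=
  if x is Some n then [set U | U (Some n)]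
  else [set U | exists2 A : set nat, F A & Some @` A `|` [set None] `<=` U].

HB.instance Definition _ := hasNbhs.Build (NF F) NF_nbhs.

Let NF_nbhs_filter (x : NF F) : ProperFilter (nbhs x).
Proof.
case: x => [n|]; split.
- by [].
- by split => // P Q PQ; apply: PQ.
- by case=> A _ AU; apply: (AU None); right.
- split.
  + by exists setT => //; exact: filterT.
  + move=> P Q [A FA AP] [B FB BQ]; exists (A `&` B); first exact: filterI.
    move=> _ [[n [An Bn] <-]|->]; split.
    * by apply: AP; left; exists n.
    * by apply: BQ; left; exists n.
    * by apply: AP; right.
    * by apply: BQ; right.
  + by move=> P Q PQ [A FA AP]; exists A => //; exact: subset_trans PQ.
Qed.

Let NF_nbhs_singleton (x : NF F) (U : set (NF F)) : nbhs x U -> U x.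
Proof. by case: x => [//|] [A _]; apply; right. Qed.

Let NF_nbhs_nbhs (x : NF F) (U : set (NF F)) :
  nbhs x U -> nbhs x (nbhs^~ U).
Proof.
case: x => [//|] [A FA AU]; exists A => // _ [[n An <-]|->].
- by apply: AU; left; exists n.
- by exists A.
Qed.

HB.instance Definition _ := Nbhs_isNbhsTopological.Build (NF F)
  NF_nbhs_filter NF_nbhs_singleton NF_nbhs_nbhs.

End NF_topology.

(* [mu : fsmeasure R T] is the signed measure on T given by the sum of
   [mu x] times the Dirac mass at x, over the finite set [finsupp mu] of the
   points x such that [mu x != 0]. *)
Definition fsmeasure (R : realType) (T : choiceType) := {fsfun T -> R with 0%R}.

Section fsmeasure.
Variables (R : realType) (T : choiceType).
Implicit Type mu : fsmeasure R T.

Definition fsmass mu (A : set T) : R :=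
  (\sum_(x <- finsupp mu | x \in A) mu x)%R.

Definition fsnorm mu : R := (\sum_(x <- finsupp mu) `|mu x|)%R.

End fsmeasure.

Definition Nikodym_property (R : realType) (F : pfilter_on nat) : Prop :=
  ~ exists mu : nat -> fsmeasure R (NF F),
      fsnorm (mu n) @[n --> \oo] --> +oo%R /\
      forall A : set (NF F), clopen A ->
        fsmass (mu n) A @[n --> \oo] --> (0 : R)%R.

Record submeasure (R : realType) := Submeasure {
  submeasure_fun :> set nat -> \bar R ;
  submeasure_ge0 : forall A, 0 <= submeasure_fun A ;
  submeasure0 : submeasure_fun set0 = 0 ;
  submeasure1_lty : forall n, submeasure_fun [set n] < +oo ;
  submeasure_le : forall A B, A `<=` B -> submeasure_fun A <= submeasure_fun B ;
  submeasureU : forall A B,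
    submeasure_fun (A `|` B) <= submeasure_fun A + submeasure_fun B
}.

Section submeasures.
Variable R : realType.
Implicit Type phi : submeasure R.

(* [`I_n.+1] is [0, n]. *)
Definition lsc phi : Prop :=
  forall A, phi (A `&` `I_n.+1) @[n --> \oo] --> phi A.

(* Measures on omega are countably additive; for lsc submeasures, finitely
   additive ones give the same notion, as the values of phi on finite sets
   determine phi. *)
Definition nonpathological phi : Prop :=
  forall A, phi A = ereal_sup
    [set mu A | mu in [set mu : {measure set nat -> \bar R} |
                        forall B, mu B <= phi B]].

Definition density_submeasure phi : Prop :=
  exists mu : nat -> fsmeasure R nat,
    [/\ forall n k, (0 <= mu n k)%R,
        trivIset setT (fun n => [set` finsupp (mu n)]) &
        forall A, phi A = ereal_sup (range (fun n => (fsmass (mu n) A)%:E))].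

Definition Exh phi : set_system nat :=
  [set A | phi (A `\` `I_n.+1) @[n --> \oo] --> 0].

End submeasures.

Definition dual_system (S : set_system nat) : set_system nat :=
  [set ~` X | X in S].

Definition Katetov_le (F G : set_system nat) : Prop :=
  exists f : nat -> nat, forall A, F A -> G (f @^-1` A).

(* Main.v *)
Require Import Defs.
From HB Require Import structures.
From mathcomp Require Import all_boot all_order all_algebra finmap.
From mathcomp Require Import all_classical all_reals all_analysis.
From mathcomp Require Import lra.
Import Order.TTheory GRing.Theory Num.Theory.
Import numFieldNormedType.Exports.

(* If mu_n witnesses the failure of the Nikodym property, a gliding hump picks a
   subsequence and consecutive intervals of omega such that the n-th term has
   large mass on the n-th interval and small mass before it.  The restrictions
   of the absolute values to the intervals have disjoint supports and tend to 0
   on the complements of elements of F, so their supremum is a density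
   submeasure as in (2), with the identity as Katetov reduction.  Conversely,
   given phi as in (3) and a reduction f, non-pathology and lower
   semicontinuity provide finitely supported measures lambda_n <= phi living
   outside [0, n] with masses tending to infinity; they tend to 0 on Exh(phi),
   and the signed measures f_* lambda_n - lambda_n(omega) delta_(p_F) contradict
   the Nikodym property. *)

Set Implicit Arguments.
Unset Strict Implicit.
Unset Printing Implicit Defensive.

Local Open Scope classical_set_scope.
Local Open Scope ring_scope.
Local Open Scope ereal_scope.

(** * Masses, norms and push-forwards of finitely supported measures *)

Section finitely_supported.
Variables (R : realType) (T : choiceType).
Implicit Types (mu : fsmeasure R T) (s : seq T) (A B : set T).

(** Points off the support contribute [f 0 = 0], so the support may be replaced by a more convenient
    list. It serves with [f] the identity, for masses, and the absolute value, for norms. *)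
Lemma fsmeasure_big (f : R -> R) mu s (P : pred T) :
  f 0%R = 0%R -> uniq s -> {subset finsupp mu <= s} ->
  (\sum_(x <- finsupp mu | P x) f (mu x) = \sum_(x <- s | P x) f (mu x))%R.
Proof.
move=> f0 us sub; rewrite [RHS](bigID (mem (finsupp mu))) /=.
rewrite [X in (_ + X)%R]big1 ?addr0; last first.
  by move=> x /andP[_]; rewrite mem_finsupp negbK => /eqP ->.
rewrite -big_filter -[RHS]big_filter; apply: perm_big.
apply: uniq_perm; rewrite ?filter_uniq ?fset_uniq // => x.
rewrite !mem_filter /=; have := sub x.
by case: (x \in finsupp mu) => [/(_ isT) ->|]; rewrite ?andbF ?andbT.
Qed.

Lemma fsmassE mu s A : uniq s -> {subset finsupp mu <= s} ->
  fsmass mu A = (\sum_(x <- s | x \in A) mu x)%R.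
Proof. exact: (@fsmeasure_big id). Qed.

Lemma fsnormE mu s : uniq s -> {subset finsupp mu <= s} ->
  fsnorm mu = (\sum_(x <- s) `|mu x|)%R.
Proof. by apply: (@fsmeasure_big (fun x => `|x|%R)); rewrite normr0. Qed.

Lemma fsmass_le_fsnorm mu A : (fsmass mu A <= fsnorm mu)%R.
Proof.
rewrite /fsmass /fsnorm big_mkcond; apply: ler_sum => x _.
by case: ifP => _; rewrite ?ler_norm ?normr_ge0.
Qed.

Lemma fsmass0 mu : fsmass mu set0 = 0%R.
Proof. by rewrite /fsmass big1 // => x; rewrite in_set0. Qed.

Lemma fsmass1 mu x : fsmass mu [set x] = mu x.
Proof.
rewrite /fsmass (eq_bigl (pred1 x)) => [|y]; last first.
  by apply/idP/eqP => [/set_mem|->]; last exact: mem_set.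
have [xm|xm] := boolP (x \in finsupp mu).
  by rewrite -big_filter filter_pred1_uniq ?fset_uniq// big_seq1.
rewrite big1_seq => [|y /andP[/eqP -> xm']]; last by rewrite xm' in xm.
by move: xm; rewrite mem_finsupp negbK => /eqP ->.
Qed.

Section nonnegative.
Variable mu : fsmeasure R T.
Hypothesis mu0 : forall x, (0 <= mu x)%R.

Lemma fsmass_ge0 A : (0 <= fsmass mu A)%R.
Proof. exact: sumr_ge0. Qed.

Lemma le_fsmass A B : A `<=` B -> (fsmass mu A <= fsmass mu B)%R.
Proof.
move=> AB; rewrite /fsmass [leLHS]big_mkcond [leRHS]big_mkcond /=.
apply: ler_sum => x _; case: ifPn => [/set_mem/AB/mem_set -> //|_].
by case: ifP.
Qed.

Lemma fsmassU A B : (fsmass mu (A `|` B) <= fsmass mu A + fsmass mu B)%R.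
Proof.
rewrite /fsmass [X in (_ <= X + _)%R]big_mkcond [X in (_ <= _ + X)%R]big_mkcond.
rewrite -big_split [leLHS]big_mkcond /=; apply: ler_sum => x _.
have := mu0 x; rewrite in_setU.
by case: (x \in A); case: (x \in B) => /= h; rewrite ?addr0 ?add0r // ler_wpDr.
Qed.

End nonnegative.

(** The image under [h] of the measure with weight [w k] at each entry [k] of [s]; weights landing
    on the same point add up. *)
Definition fspush (I : eqType) (s : seq I) (h : I -> T) (w : I -> R)
    : fsmeasure R T :=
  [fsfun y in seq_fset tt (map h s) =>
    (\sum_(k <- s | h k == y) w k)%R].

Lemma fspushE (I : eqType) (s : seq I) h (w : I -> R) y :
  fspush s h w y = (\sum_(k <- s | h k == y) w k)%R.
Proof.
rewrite fsfun_fun seq_fsetE; case: ifPn => // ys.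
elim: s ys => [|k s IH]; first by rewrite big_nil.
rewrite /= in_cons negb_or big_cons => /andP[yk /IH <-].
by rewrite eq_sym (negPf yk).
Qed.

Lemma fsmass_fspush (I : eqType) (s : seq I) h (w : I -> R) A :
  fsmass (fspush s h w) A = (\sum_(k <- s | h k \in A) w k)%R.
Proof.
rewrite (@fsmassE _ (seq_fset tt (map h s))) ?fset_uniq//; last first.
  move=> y; rewrite mem_finsupp fsfun_fun.
  by case: ifP => //; rewrite eqxx.
rewrite (eq_bigr _ (fun y _ => fspushE s h w y)).
rewrite (exchange_big_dep (fun k => h k \in A)) /= => [|y k yA /eqP -> //].
rewrite [LHS]big_seq_cond [RHS]big_seq_cond.
apply: eq_bigr => k /andP[ks kA].
rewrite (eq_bigl (pred1 (h k))) => [|y]; last first.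
  by rewrite /= eq_sym; case: eqP => [->|_]; rewrite ?kA ?andbF.
have hk : h k \in seq_fset tt (map h s) by rewrite seq_fsetE map_f.
by rewrite -big_filter filter_pred1_uniq ?fset_uniq// big_seq1.
Qed.
End finitely_supported.

Lemma cvge0_lt (R : realType) (u : nat -> \bar R) (e : R) :
  u n @[n --> \oo] --> 0 -> (0 < e)%R -> \forall n \near \oo, u n < e%:E.
Proof.
move=> u0 e0; exact: (u0 _ (@nbhs_open_ereal_lt _ 0%R (fun=> e) e0)).
Qed.

(** * The density submeasure of a disjointly supported sequence *)

Section submeasure_sup.
Variables (R : realType) (nu : nat -> fsmeasure R nat).
Hypothesis nu0 : forall n k, (0 <= nu n k)%R.
Hypothesis nu_disj : trivIset setT (fun n => [set` finsupp (nu n)]).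

Definition fssup (A : set nat) : \bar R :=
  ereal_sup (range (fun n => (fsmass (nu n) A)%:E)).

Lemma fsmass_le_fssup n A : (fsmass (nu n) A)%:E <= fssup A.
Proof. by apply: ereal_sup_ubound; exists n. Qed.

Lemma fssup_le A (x : \bar R) :
  (forall n, (fsmass (nu n) A)%:E <= x) -> fssup A <= x.
Proof. by move=> Ax; apply: ge_ereal_sup => _ [n _ <-]. Qed.

Lemma fssup_ge0 A : 0 <= fssup A.
Proof.
by apply: le_trans (fsmass_le_fssup 0 A); rewrite lee_fin fsmass_ge0.
Qed.

Lemma fssup0 : fssup set0 = 0.
Proof.
apply/eqP; rewrite eq_le fssup_ge0 andbT; apply: fssup_le => n.
by rewrite fsmass0.
Qed.

(** Disjointness of the supports enters here: at most one [nu n] charges [k], so the supremum is a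
    single real value. *)
Lemma fssup1_lty k : fssup [set k] < +oo.
Proof.
have [[n nk]|nuk0] := pselect (exists n, nu n k != 0%R); last first.
  apply: (@le_lt_trans _ _ 0); last exact: ltry.
  apply: fssup_le => n; rewrite fsmass1 lee_fin leNgt.
  by apply/negP => nk; apply: nuk0; exists n; rewrite gt_eqF.
apply: (@le_lt_trans _ _ (nu n k)%:E); last exact: ltry.
apply: fssup_le => m; rewrite fsmass1 lee_fin.
have [->//|mk] := eqVneq (nu m k) 0%R.
suff -> : m = n by [].
by apply: (nu_disj I I); exists k; rewrite /= !mem_finsupp.
Qed.

Lemma le_fssup A B : A `<=` B -> fssup A <= fssup B.
Proof.
move=> AB; apply: fssup_le => n; apply: le_trans (fsmass_le_fssup n B).
by rewrite lee_fin le_fsmass.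
Qed.

Lemma fssupU A B : fssup (A `|` B) <= fssup A + fssup B.
Proof.
apply: fssup_le => n.
apply: le_trans (leeD (fsmass_le_fssup n A) (fsmass_le_fssup n B)).
by rewrite -EFinD lee_fin fsmassU.
Qed.

Definition density_of : submeasure R :=
  Submeasure fssup_ge0 fssup0 fssup1_lty le_fssup fssupU.

Lemma density_submeasure_of : density_submeasure density_of.
Proof. by exists nu. Qed.

End submeasure_sup.

Lemma finsupp_bound (R : realType) (mu : fsmeasure R nat) :
  exists N, {subset finsupp mu <= index_iota 0 N}.
Proof.
exists (\max_(k <- finsupp mu) k).+1 => k kmu.
by rewrite mem_index_iota ltnS (big_rem k)//= leq_maxl.
Qed.

(** * Density submeasures are non-pathological and lsc *)

Section density_nonpathological_lsc.
Variables (R : realType) (phi : submeasure R).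
Hypothesis phi_density : density_submeasure phi.

Lemma fsmass_measure (mu : fsmeasure R nat) : (forall k, (0 <= mu k)%R) ->
  exists m : {measure set nat -> \bar R}, forall A, m A = (fsmass mu A)%:E.
Proof.
move=> mu0; have [N sub] := finsupp_bound mu.
exists (msum (fun k => mscale (NngNum (mu0 k)) \d_k) N) => A.
rewrite /= /msum (fsmassE _ (iota_uniq _ _) sub) big_mkord -sumEFin.
rewrite [RHS]big_mkcond.
apply: eq_bigr => k _ /=.
by rewrite /mscale /= diracE -EFinM; case: (_ \in A); rewrite ?mulr1 ?mulr0.
Qed.

Lemma density_nonpathological : nonpathological phi.
Proof.
have [nu [nu0 nu_disj phiE]] := phi_density.
move=> A; apply/eqP; rewrite eq_le; apply/andP; split; last first.
  by apply: ge_ereal_sup => _ [m mphi <-].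
rewrite [leLHS]phiE; apply: ge_ereal_sup => _ [n _ <-].
have [m mE] := fsmass_measure (nu0 n).
apply: ereal_sup_ubound; exists m => // B.
by rewrite mE phiE fsmass_le_fssup.
Qed.

(** Each [nu n] has bounded support, so its mass on [A] is already its mass on a long enough initial
    segment of [A]. *)
Lemma density_lsc : lsc phi.
Proof.
have [nu [nu0 nu_disj phiE]] := phi_density.
move=> A.
suff -> : phi A = ereal_sup (range (fun n => phi (A `&` `I_n.+1))).
  apply: ereal_nondecreasing_cvgn => m n mn; apply: submeasure_le.
  by move=> k [Ak /= km]; split => //=; exact: leq_trans km _.
apply/eqP; rewrite eq_le; apply/andP; split; last first.
  by apply: ge_ereal_sup => _ [n _ <-]; apply: submeasure_le => k [].
rewrite [leLHS]phiE; apply: ge_ereal_sup => _ [n _ <-].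
have [N sub] := finsupp_bound (nu n).
apply: (@le_trans _ _ (phi (A `&` `I_N.+1))); last first.
  by apply: ereal_sup_ubound; exists N.
rewrite phiE; apply: le_trans (fsmass_le_fssup _ n _); rewrite lee_fin.
rewrite !(fsmassE _ (iota_uniq _ _) sub).
rewrite [leLHS]big_seq_cond [leRHS]big_seq_cond.
rewrite le_eqVlt; apply/orP; left; apply/eqP; apply: eq_bigl => k.
case: (boolP (k \in _)) => //= kN.
apply/idP/idP => [/set_mem Ak|/set_mem[Ak _]]; apply/mem_set => //.
split => //=; move: kN; rewrite mem_iota => /andP[_ /ltnW].
by rewrite subn0 add0n ltnS.
Qed.

End density_nonpathological_lsc.

(** * Clopen subsets of [NF F] *)

Section clopen_NF.
Variable F : pfilter_on nat.

Lemma open_NFP (U : set (NF F)) : open U <-> (U None -> F (Some @^-1` U)).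
Proof.
rewrite openE; split=> [Uo UN|UF [n|]].
- have [A FA AU] := Uo _ UN.
  by apply: filterS FA => k Ak; apply: AU; left; exists k.
- by [].
- move=> UN; exists (Some @^-1` U); first exact: UF.
  by move=> _ [[k Uk <-]|->].
Qed.

(** Openness needs testing only at [None], and exactly one of [U] and its complement contains
    [None]; that one carries the whole condition. *)
Lemma clopen_NFP (U : set (NF F)) :
  clopen U <-> F (Some @^-1` (if None \in U then U else ~` U)).
Proof.
rewrite /clopen -openC !open_NFP; case: (boolP (None \in U)) => UN.
- have {}UN := set_mem UN.
  by split=> [[+ _]|?]; [apply|split].
- have {}UN : ~ U None by move=> /mem_set; exact/negP.
  by split=> [[_]|?]; [apply|split].
Qed.

Lemma clopen_NF_some (B : set nat) : F (~` B) ->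
  clopen (Some @` B : set (NF F)).
Proof.
move=> FB; apply/clopen_NFP; rewrite ifF; last first.
  by apply/negbTE/negP => /set_mem[].
by apply: filterS FB => k Bk [j Bj [jk]]; apply: Bk; rewrite -jk.
Qed.

End clopen_NF.

(** * From a non-pathological lsc submeasure to the failure of the Nikodym property *)

Lemma sum_measure1 (R : realType) (m : {measure set nat -> \bar R})
    (s : seq nat) : uniq s ->
  \sum_(k <- s) m [set k] = m [set` s].
Proof.
elim: s => [_|k s IH /= /andP[ks us]].
  by rewrite big_nil set_nil measure0.
rewrite big_cons IH // -measureU//.
  congr (m _); apply/seteqP; split=> j /=; rewrite in_cons.
    by move=> [->|->]; rewrite ?eqxx ?orbT.
  by move=> /orP[/eqP|]; [left|right].
by apply/seteqP; split => // j [/= -> ks']; move: ks; rewrite ks'.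
Qed.

Section nonpathological_lsc.
Variables (R : realType) (phi : submeasure R).
Hypothesis phi_np : nonpathological phi.
Hypothesis phi_lsc : lsc phi.
Hypothesis phiT : phi setT = +oo.

Lemma submeasure_initial_lty n : phi `I_n < +oo.
Proof.
elim: n => [|n IH]; first by rewrite II0 submeasure0.
rewrite IIS; apply: le_lt_trans (submeasureU _ _ _) _.
by rewrite lte_add_pinfty// submeasure1_lty.
Qed.

Lemma submeasure_tail n : phi (~` `I_n) = +oo.
Proof.
have := submeasureU phi `I_n (~` `I_n); rewrite setUv phiT.
have := submeasure_initial_lty n.
case: (phi (~` `I_n)) => //= x;
  by case: (phi `I_n) (submeasure_ge0 phi `I_n).
Qed.

(** The tail beyond [n] has infinite value, so by lower semicontinuity some finite piece of it has
    value above [n], and by non-pathology some measure below [phi] has mass above [n] on that piece.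
    The weights are the point masses of this measure. *)
Lemma finite_weight_below n : exists s : seq nat, exists w : nat -> R,
  [/\ forall k, (0 <= w k)%R,
      (n%:R <= \sum_(k <- s) w k)%R &
      forall B, (\sum_(k <- s | k \in B) w k)%:E <= phi (B `\` `I_n)].
Proof.
have : phi (~` `I_n `&` `I_k.+1) @[k --> \oo] --> +oo.
  by rewrite -[X in _ --> X](submeasure_tail n); exact: phi_lsc.
move=> /cvgeyPgt/(_ n%:R)[k _ /(_ k (leqnn k))] /=.
rewrite phi_np => /ereal_sup_gt[_ [m mphi <-]] mn.
have {}mphi : forall B, m B <= phi B := mphi.
pose s := index_iota n k.+1.
have sE : [set` s] = ~` `I_n `&` `I_k.+1.
  apply/seteqP; split=> j /=; rewrite mem_index_iota.
    by move=> /andP[nj jk]; split => //; apply/negP; rewrite -leqNgt.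
  by move=> [/negP]; rewrite -leqNgt => -> ->.
(* Finiteness of [phi] on singletons makes the passage to real weights by [fine] lossless. *)
have mfin j : m [set j] \is a fin_num.
  by rewrite ge0_fin_numE// (le_lt_trans (mphi _))// submeasure1_lty.
have mE (B : set nat) : (\sum_(j <- s | j \in B) fine (m [set j]))%:E =
    m [set` [seq j <- s | j \in B]].
  rewrite -sum_measure1 ?filter_uniq ?iota_uniq// big_filter -sumEFin.
  by apply: eq_bigr => j _; rewrite fineK.
exists s, (fun j => fine (m [set j])); split.
- by move=> j; rewrite fine_ge0.
- have sT : [seq j <- s | j \in (setT : set nat)] = s.
    by apply/all_filterP/allP => j _; exact: mem_set.
  by rewrite -lee_fin -[in leRHS]sT big_filter mE sT sE ltW.
- move=> B; rewrite mE; apply: le_trans (mphi _) _; apply: submeasure_le.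
  move=> j /=; rewrite mem_filter mem_index_iota.
  move=> /andP[/set_mem Bj /andP[nj _]].
  by split => //=; apply/negP; rewrite -leqNgt.
Qed.

Lemma Katetov_not_Nikodym (F : pfilter_on nat) :
  Katetov_le F (dual_system (Exh phi)) -> ~ Nikodym_property R F.
Proof.
move=> [f Ff]; apply.
have /choice[s /choice[w sw]] := fun n => finite_weight_below n.+1.
pose tot n := (\sum_(k <- s n) w n k)%R.
(* [omap f] fixes [None], whose weight [- tot n] makes the total mass zero. *)
pose mu n : fsmeasure R (NF F) := fspush (None :: map Some (s n)) (omap f)
  (fun x => if x is Some k then w n k else - tot n)%R.
have muE n A : fsmass (mu n) A = ((if None \in A then - tot n else 0) +
    \sum_(k <- s n | Some (f k) \in A) w n k)%R.
  rewrite /mu fsmass_fspush big_cons big_map /=.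
  by case: ifP; rewrite ?add0r.
have small (B : set nat) : Exh phi B ->
    (\sum_(k <- s n | k \in B) w n k)%R @[n --> \oo] --> (0 : R)%R.
  move=> /cvge0_lt EB; apply/cvgr0Pnorm_lt => e e0.
  near=> n; have [w0 _ /(_ B) wB] := sw n.
  rewrite ger0_norm ?sumr_ge0// -lte_fin (le_lt_trans wB)//.
  by near: n; exact: EB.
exists mu; split.
  apply/cvgryPge => C; near=> n; have [_ wn _] := sw n.
  apply: le_trans (fsmass_le_fsnorm (mu n) (Some @` setT)).
  rewrite muE ifF; last by apply/negbTE/negP => /set_mem[].
  rewrite add0r (eq_bigl xpredT) => [|k]; last by apply/mem_set; exists (f k).
  apply: le_trans wn; apply: (@le_trans _ _ n%:R)%R; last by rewrite ler_nat.
  by near: n; exact: nbhs_infty_ger.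
move=> A /clopen_NFP FA.
have [B EB BE] := Ff _ FA.
have BA k : (k \in B) = (Some (f k) \in (if None \in A then ~` A else A)).
  have -> : B = ~` (f @^-1` (Some @^-1` (if None \in A then A else ~` A))).
    by rewrite -BE setCK.
  by case: ifP => _; apply/idP/idP => /set_mem h; apply/mem_set => //;
    exact: contrapT.
have := small _ EB; case: ifP BA => NA BA; last first.
  apply: cvg_trans; apply: near_eq_cvg; near=> n.
  by rewrite muE NA add0r; apply: eq_bigl.
(* When [None] lies in [A], the mass of [A] is the weight off [B] minus the total, that is, minus
   the weight of [B]. *)
move=> /cvgN; rewrite oppr0; apply: cvg_trans; apply: near_eq_cvg; near=> n.
rewrite muE NA /tot /= [in RHS](bigID (fun k => k \in B)) /= opprD -addrA.
rewrite [X in (_ + (_ + X))%R](eq_bigl (fun k => k \notin B)) => [|k].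
  by rewrite addNr addr0.
by rewrite BA in_setC negbK.
Unshelve. all: by end_near.
Qed.

End nonpathological_lsc.

(** * The gliding hump and the density submeasure it yields *)

Section not_Nikodym.
Variables (R : realType) (F : pfilter_on nat).

Lemma finsupp_NF_bound (mu : fsmeasure R (NF F)) : exists N,
  {subset finsupp mu <= (None :: map Some (index_iota 0 N) : seq (NF F))}.
Proof.
exists (\max_(x <- finsupp mu) odflt 0%N x).+1 => -[k|] kmu; last first.
  by rewrite in_cons.
rewrite in_cons mem_map => [|? ? []//].
by rewrite mem_index_iota ltnS (big_rem (Some k))//= leq_maxl.
Qed.

Section bounded_support.
Variables (mu : fsmeasure R (NF F)) (N : nat).
Hypothesis muN :
  {subset finsupp mu <= (None :: map Some (index_iota 0 N) : seq (NF F))}.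

Let uniq_support : uniq (None :: map Some (index_iota 0 N) : seq (NF F)).
Proof.
rewrite /= map_inj_uniq ?iota_uniq => [|? ? []//].
by rewrite andbT; apply/mapP => -[].
Qed.

Lemma fsmass_NF (A : set (NF F)) : fsmass mu A =
  ((if None \in A then mu None else 0) +
   \sum_(0 <= k < N | Some k \in A) mu (Some k))%R.
Proof.
rewrite (fsmassE _ uniq_support muN) big_cons big_map.
by case: ifP; rewrite ?add0r.
Qed.

Lemma fsnorm_NF :
  fsnorm mu = (`|mu None| + \sum_(0 <= k < N) `|mu (Some k)|)%R.
Proof. by rewrite (fsnormE uniq_support muN) big_cons big_map. Qed.

Lemma fsmass_NF_some (B : set nat) :
  fsmass mu (Some @` B) = (\sum_(0 <= k < N | k \in B) mu (Some k))%R.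
Proof.
rewrite fsmass_NF ifF ?add0r; last by apply/negbTE/negP => /set_mem[].
apply: eq_bigl => k; apply/idP/idP => /set_mem.
  by move=> [j Bj [<-]]; exact: mem_set.
by move=> Bk; apply/mem_set; exists k.
Qed.

Lemma NF_eq0 k : (N <= k)%N -> mu (Some k) = 0%R.
Proof.
move=> Nk; apply/eqP/negPn; rewrite -mem_finsupp; apply/negP => /muN.
rewrite in_cons mem_map => [|? ? []//].
by rewrite mem_index_iota ltnNge Nk.
Qed.

(** The atom at [None] is the total mass minus the sum over omega, so the triangle inequality bounds
    it by the other two quantities. *)
Lemma fsnorm_NF_le : (fsnorm mu <=
  `|fsmass mu setT| + 2 * \sum_(0 <= k < N) `|mu (Some k)|)%R.
Proof.
have tri := ler_norm_sum (index_iota 0 N) (fun k => mu (Some k)) xpredT.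
rewrite fsnorm_NF fsmass_NF (in_setT (None : NF F)).
rewrite [X in (`|_ + X| + _)%R](eq_bigl xpredT) => [|k]; last exact: mem_set.
move: tri; set S := (\sum_(0 <= k < N) mu (Some k))%R.
set t := (\sum_(0 <= k < N) _)%R => tri.
have := ler_normB (mu None + S)%R S; rewrite addrK; lra.
Qed.

End bounded_support.

(** Freeness makes the singletons of omega clopen, so the mass on any fixed head tends to 0. The
    total masses tend to 0 as well, so by [fsnorm_NF_le] the norms can blow up only if the part on
    omega does. *)
Lemma gliding_hump (hF : free_filter F) (mu : nat -> fsmeasure R (NF F))
    (N : nat -> nat) :
  (forall n, {subset finsupp (mu n) <=
     (None :: map Some (index_iota 0 (N n)) : seq (NF F))}) ->
  fsnorm (mu n) @[n --> \oo] --> +oo%R ->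
  (forall A : set (NF F), clopen A ->
     fsmass (mu n) A @[n --> \oo] --> (0 : R)%R) ->
  forall j K, exists n, [/\ (j <= n)%N,
    (\sum_(0 <= k < K) `|mu n (Some k)| <= j.+1%:R^-1)%R &
    (j.+1%:R <= \sum_(0 <= k < N n) `|mu n (Some k)|)%R].
Proof.
move=> muN norm_oo mass0 j K.
have point0 k : mu n (Some k) @[n --> \oo] --> (0 : R)%R.
  have [A FA Ak] : exists2 A, F A & ~ A k.
    apply: contrapT => noA; suff : set0 k by [].
    rewrite -hF => A FA; apply: contrapT => nAk; apply: noA; by exists A.
  have := mass0 (Some @` [set k]).
  rewrite image_set1; under eq_fun do rewrite fsmass1; apply.
  rewrite -image_set1; apply: clopen_NF_some.
  by apply: filterS FA => i Ai ik; apply: Ak; rewrite -ik.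
have small : (\sum_(0 <= k < K) `|mu n (Some k)|)%R @[n --> \oo] --> (0 : R)%R.
  rewrite [X in _ --> X](_ : _ = \sum_(0 <= k < K) 0)%R; last by rewrite big1.
  apply: cvg_big => [|k _]; first exact: add_continuous.
  by rewrite -[X in _ --> X](normr0 R); apply: cvg_norm.
have whole0 := mass0 setT clopenT.
near \oo => n.
exists n; split.
- by near: n; exists j.
- apply: le_trans (ler_norm _) _; apply: ltW.
  near: n; move/cvgr0Pnorm_lt : small; apply.
  by rewrite invr_gt0 ltr0n.
- have := fsnorm_NF_le (muN n).
  have : (`|fsmass (mu n) setT| < 1)%R.
    by near: n; move/cvgr0Pnorm_lt : whole0; apply; exact: ltr01.
  (* In [fsnorm_NF_le] the 1 pays for the total mass and the 2 for the factor in front of the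
     sum. *)
  have : (2 * j.+1%:R + 1 <= fsnorm (mu n))%R.
    by near: n; move/cvgryPge : norm_oo; apply.
  by lra.
Unshelve. all: by end_near.
Qed.

Lemma not_Nikodym_density (hF : free_filter F) : ~ Nikodym_property R F ->
  exists phi : submeasure R, [/\ density_submeasure phi, phi setT = +oo &
    Katetov_le F (dual_system (Exh phi))].
Proof.
move=> /contrapT[mu [norm_oo mass0]].
have /choice[N muN] := fun n => finsupp_NF_bound (mu n).
have /choice[c0 c0P] := fun jK : nat * nat =>
  gliding_hump hF muN norm_oo mass0 jK.1 jK.2.
(* The [i]-th measure is chosen with small head below [K i]; the next cut is put past its support,
   and the maximum keeps [K] monotone. *)
pose K := fix K j := if j is i.+1 then maxn (K i) (N (c0 (i, K i))) else 0%N.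
pose c j := c0 (j, K j).
have KS j : (K j <= K j.+1)%N by rewrite leq_maxl.
have NK j : (N (c j) <= K j.+1)%N by rewrite leq_maxr.
clearbody K.
have Kmono : {homo K : i j / (i <= j)%N}.
  by apply: homo_leq leq_trans KS; exact: leqnn.
have c_ge j : (j <= c j)%N by have [] := c0P (j, K j).
have head j : (\sum_(0 <= k < K j) `|mu (c j) (Some k)| <= j.+1%:R^-1)%R.
  by have [] := c0P (j, K j).
have big j : (j.+1%:R <= \sum_(0 <= k < N (c j)) `|mu (c j) (Some k)|)%R.
  by have [] := c0P (j, K j).
pose nu j : fsmeasure R nat :=
  fspush (index_iota (K j) (K j.+1)) id (fun k => `|mu (c j) (Some k)|%R).
have block i j k : (K i <= k < K i.+1)%N -> (K j <= k < K j.+1)%N -> i = j.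
  move=> /andP[ik ki] /andP[jk kj]; apply/eqP; rewrite eqn_leq.
  apply/andP; split; rewrite leqNgt; apply/negP => /Kmono h.
    by move: (leq_trans kj h); rewrite ltnNge ik.
  by move: (leq_trans ki h); rewrite ltnNge jk.
have nu0 j k : (0 <= nu j k)%R by rewrite fspushE sumr_ge0.
have nu_supp j k : k \in finsupp (nu j) -> (K j <= k < K j.+1)%N.
  rewrite mem_finsupp -mem_index_iota; apply: contraNT => kj.
  rewrite fspushE big_seq_cond big1// => i /andP[ij /eqP ik].
  by rewrite -ik ij in kj.
have nu_disj : trivIset setT (fun j => [set` finsupp (nu j)]).
  by move=> i j _ _ [k [/nu_supp ki /nu_supp kj]]; exact: block ki kj.
(* Both sides are compared with the sum up to [K j.+1], since [mu (c j)] vanishes on omega from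
   [N (c j)] on; [N (c j)] may lie below [K j]. *)
have split_sum j (P : pred nat) (f : R -> R) : f 0%R = 0%R ->
    (\sum_(0 <= k < N (c j) | P k) f (mu (c j) (Some k)) =
     \sum_(0 <= k < K j | P k) f (mu (c j) (Some k)) +
     \sum_(K j <= k < K j.+1 | P k) f (mu (c j) (Some k)))%R.
  move=> f0; rewrite -(big_cat_nat (leq0n _) (KS j)) /=.
  rewrite [RHS](big_cat_nat (leq0n _) (NK j))/=.
  rewrite [X in (_ = _ + X)%R]big_nat_cond [X in (_ + X)%R]big1 ?addr0//.
  by move=> k /andP[/andP[Nk _] _]; rewrite (NF_eq0 (muN _)).
(* Of a mass at least [j.+1], the head takes at most 1. *)
have nu_big j : (j%:R <= fsmass (nu j) setT)%R.
  rewrite fsmass_fspush (eq_bigl xpredT) => [|k]; last exact: mem_set.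
  have := big j; rewrite (split_sum j xpredT (fun x => `|x|%R)) ?normr0//=.
  have := head j.
  have : (j.+1%:R^-1 <= 1 :> R)%R by rewrite invf_le1 ?ler1n ?ltr0n.
  have : (j%:R + 1 = j.+1%:R :> R)%R := natr1 _.
  have arith (x y v s t : R) :
    (x + 1 = y -> v <= 1 -> s <= v -> y <= s + t -> x <= t)%R by lra.
  exact: arith.
have restr0 (B : set nat) : F (~` B) ->
    (\sum_(K j <= k < K j.+1 | k \in B) mu (c j) (Some k))%R
    @[j --> \oo] --> (0 : R)%R.
  move=> FB; apply/cvgr0Pnorm_le => e e0.
  have e2 : (0 < e / 2)%R by rewrite divr_gt0.
  have /cvgr0Pnorm_lt/(_ _ e2)[M _ HM] := mass0 _ (clopen_NF_some FB).
  near=> j.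
  have := fsmass_NF_some (muN (c j)) B; rewrite (split_sum j _ id)// => E.
  have h1 : (`|fsmass (mu (c j)) (Some @` B)| < e / 2)%R.
    apply: HM; apply: leq_trans (c_ge j); near: j; by exists M.
  have h2 : (`|\sum_(0 <= k < K j | k \in B) mu (c j) (Some k)| <= e / 2)%R.
    apply: le_trans (ler_norm_sum _ _ _) _.
    apply: (@le_trans _ _ j.+1%:R^-1)%R.
      apply: le_trans (head j); rewrite [leLHS]big_mkcond.
      by apply: ler_sum => k _; case: ifP.
    apply: ltW; near: j.
    exact: (near_infty_natSinv_lt (PosNum e2)).
  have := ler_normB (fsmass (mu (c j)) (Some @` B))
    (\sum_(0 <= k < K j | k \in B) mu (c j) (Some k))%R.
  rewrite {1}E addrC addKr; lra.
have nu_cvg0 (A : set nat) : F (~` A) ->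
    fsmass (nu j) A @[j --> \oo] --> (0 : R)%R.
  move=> FA.
  (* The blocks are disjoint, so the signs of all the measures are recorded by
     the single set B, and nu_j(A) = mu_(c j)(A `&` B) - mu_(c j)(A `\` B) on
     the j-th block. *)
  pose B : set nat := [set k | A k /\
    exists j, (K j <= k < K j.+1)%N /\ (0 <= mu (c j) (Some k))%R].
  have FB : F (~` B) by apply: filterS FA => k Ak [].
  have FC : F (~` (A `\` B)) by apply: filterS FA => k Ak [].
  have /cvgB/(_ (restr0 _ FC)) := restr0 _ FB.
  rewrite subr0; apply: cvg_trans; apply: near_eq_cvg; near=> j.
  rewrite fsmass_fspush [X in (X - _)%R = _]big_mkcond.
  rewrite [X in (_ - X)%R = _]big_mkcond [RHS]big_mkcond /= -sumrB.
  rewrite [LHS]big_nat_cond [RHS]big_nat_cond.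
  apply: eq_bigr => k; rewrite andbT => kj.
  have [Ak|Ak] := boolP (k \in A); last first.
    rewrite !ifF ?subr0//; apply/negbTE; apply: contra Ak => /set_mem[Ak _];
      exact: mem_set.
  have [Bk|Bk] := boolP (k \in B).
    rewrite ifF ?subr0; last first.
      by apply/negbTE; rewrite in_setD Bk andbF.
    have [_ [i [ki]]] := set_mem Bk.
    by rewrite (block _ _ _ ki kj) => mu_ge0; rewrite ger0_norm.
  rewrite ifT; last by rewrite in_setD Ak.
  rewrite sub0r ltr0_norm// ltNge; apply: contra Bk => mu_ge0.
  by apply/mem_set; split; [exact: set_mem|exists j].
exists (density_of nu0 nu_disj); split.
- exact: density_submeasure_of.
- apply/eqyP => r r0; apply: le_trans (fsmass_le_fssup nu (Num.trunc r).+1 _).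
  by rewrite lee_fin (le_trans _ (nu_big _))// ltW// truncnS_gt.
exists id => A FA; exists (~` A); last by rewrite setCK.
have /nu_cvg0 nuA : F (~` ~` A) by rewrite setCK.
rewrite /Exh /=.
(* This sequence is nonincreasing, so it is enough that its infimum is 0. *)
set u := (fun n => fssup nu (~` A `\` `I_n.+1)).
have u_inf : u n @[n --> \oo] --> ereal_inf (range u).
  apply: ereal_nonincreasing_cvgn => m n mn; apply: le_fssup => //.
  by move=> k [Ak nk]; split => // /= km; apply: nk; exact: leq_trans km _.
suff <- : ereal_inf (range u) = 0 by exact: u_inf.
apply/eqP; rewrite eq_le; apply/andP; split; last first.
  by apply: le_ereal_inf_tmp => _ [n _ <-]; exact: fssup_ge0.
apply/lee_addgt0Pr => e e0; rewrite add0e.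
have /cvgr0Pnorm_lt/(_ _ e0)[M _ HM] := nuA.
apply: (@le_trans _ _ (u (K M))).
  by apply: ereal_inf_lbound; exists (K M).
apply: fssup_le => j; rewrite lee_fin.
have [Mj|jM] := leqP M j.
  apply: le_trans (ltW (le_lt_trans (ler_norm _) (HM j Mj))).
  by apply: le_fsmass => // k [].
rewrite fsmass_fspush big_nat_cond big1 ?ltW// => k.
move=> /andP[/andP[_ kj] /set_mem[_]] [].
by apply: leq_trans kj _; exact: leq_trans (Kmono _ _ jM) _.
Unshelve. all: by end_near.
Qed.

End not_Nikodym.

Theorem mainTheorem12 (R : realType) (F : pfilter_on nat)
    (hF : free_filter F) :
  [<-> ~ Nikodym_property R F ;
       exists phi : submeasure R,
         [/\ density_submeasure phi, phi setT = +oo &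
             Katetov_le F (dual_system (Exh phi))] ;
       exists phi : submeasure R,
         [/\ nonpathological phi, lsc phi, phi setT = +oo &
             Katetov_le F (dual_system (Exh phi))]].
Proof.
tfae.
- exact: not_Nikodym_density.
- move=> [phi [dphi phiT Fphi]]; exists phi; split => //.
    exact: density_nonpathological.
  exact: density_lsc.
- by move=> [phi [np lscphi phiT]]; exact: Katetov_not_Nikodym.
Qed.
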